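(* Let $0<\alpha<1$, $1<p<\frac1\alpha$, $\frac1q=\frac1p-\alpha$ and $q<2p$. Set $s=\frac{qp}{2p-q}$ and let $\omega\in\mathcal{A}(p,q)$. Then $I_\alpha x\in l^q_{s\,(\omega^q,\omega^q)}$ for every $x\in l^p_{q\,(\omega^p,\omega^q)}$, and there exists a positive constant $C$, independent of $x$, such that $$\|I_\alpha x\|_{l^q_{s\,(\omega^q,\omega^q)}}\le C\|x\|_{l^p_{q\,(\omega^p,\omega^q)}}\qquad\text{for all }x\in l^p_{q\,(\omega^p,\omega^q)}.$$
   Context: Sequences are real, $x=\{x(k)\}_{k\in\mathbb{Z}}\subset\mathbb{R}$. $\mathbb{N}=\{0,1,2,\dots\}$. For $m\in\mathbb{Z}$, $N\in\mathbb{N}$, $S_{m,N}:=\{k\in\mathbb{Z}:|k-m|\le N\}$. A discrete weight is a sequence $\omega=\{\omega(k)\}_{k\in\mathbb{Z}}$ of positive reals; powers $\omega^r$ are pointwise; for finite $A\subset\mathbb{Z}$, $\omega(A):=\sum_{k\in A}\omega(k)$. Discrete weighted Morrey space: for $1\le p\le q<\infty$ and weights $u,v$, $l^p_{q\,(u,v)}$ is the space of sequences with $$\|x\|_{l^p_{q\,(u,v)}}:=\sup_{m\in\mathbb{Z},N\in\mathbb{N}}\big(v(S_{m,N})\big)^{\frac1q-\frac1p}\Big(\sum_{k\in S_{m,N}}|x(k)|^pu(k)\Big)^{\frac1p}<\infty .$$ An interval $J\subset\mathbb{Z}$ is a finite nonempty set of consecutive integers, and $|J|$ is its cardinality. For $1<p,q<\infty$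 and $p'=p/(p-1)$, $\omega\in\mathcal{A}(p,q)$ means $$\sup_{J}\Big(\frac1{|J|}\sum_{k\in J}\omega(k)^q\Big)^{\frac1q}\Big(\frac1{|J|}\sum_{k\in J}\omega(k)^{-p'}\Big)^{\frac1{p'}}<\infty,$$ the supremum being over all intervals $J\subset\mathbb{Z}$. Discrete Riesz potential: $I_\alpha x(k):=\sum_{i\in\mathbb{Z}\setminus\{k\}}\frac{x(i)}{|k-i|^{1-\alpha}}$, $k\in\mathbb{Z}$. *)

(* Defs.v *)
From HB Require Import structures.
From mathcomp Require Import all_boot all_order all_algebra finmap.
From mathcomp Require Import all_classical all_reals all_analysis.

Set Implicit Arguments.
Unset Strict Implicit.
Unset Printing Implicit Defensive.

Import Order.TTheory GRing.Theory Num.Theory.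
Import numFieldNormedType.Exports.

Local Open Scope classical_set_scope.
Local Open Scope ring_scope.

Definition ball_int (m : int) (N : nat) : set int :=
  [set k | `|k - m| <= N%:Z].

Definition is_weight (R : realType) (w : int -> R) : Prop :=
  forall k, 0 < w k.

Definition wpow (R : realType) (w : int -> R) (r : R) : int -> R :=
  fun k => w k `^ r.

(* The sums below are over finite sets, so \sum_(_ \in _) is the plain sum. *)
Definition wsum (R : realType) (w : int -> R) (A : set int) : R :=
  \sum_(k \in A) w k.

(* Extended-real-valued; x belongs to the space iff the value is finite. *)
Definition morrey_norm (R : realType) (p q : R) (u v x : int -> R) : \bar R :=
  ereal_sup
    [set (wsum v (ball_int m N) `^ (q^-1 - p^-1) *
          (\sum_(k \in ball_int m N) `|x k| `^ p * u k) `^ p^-1)%:E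
    | m in [set: int] & N in [set: nat]].

Definition in_morrey (R : realType) (p q : R) (u v x : int -> R) : Prop :=
  (morrey_norm p q u v x < +oo)%E.

Definition int_interval : set (set int) :=
  [set J | exists a b : int, a <= b /\ J = `[a, b]%classic].

Definition average (R : realType) (J : set int) (f : int -> R) : R :=
  (#|` fset_set J|%:R)^-1 * \sum_(k \in J) f k.

Definition conj_exp (R : realType) (p : R) : R := p / (p - 1).

Definition A_pq (R : realType) (p q : R) (w : int -> R) : Prop :=
  (ereal_sup
    [set (average J (wpow w q) `^ q^-1 *
          average J (wpow w (- conj_exp p)) `^ (conj_exp p)^-1)%:E
    | J in int_interval] < +oo)%E.

Definition riesz_term (R : realType) (alpha : R) (x : int -> R) (k i : int)
    : \bar R :=
  (x i / (`|k - i|%:~R `^ (1 - alpha)))%:E.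

Definition riesz_defined (R : realType) (alpha : R) (x : int -> R) : Prop :=
  forall k, summable (~` [set k]) (riesz_term alpha x k).

(* Sum of the positive parts minus sum of the negative parts; this is the
   value of the series at k when it converges absolutely (riesz_defined). *)
Definition riesz (R : realType) (alpha : R) (x : int -> R) : int -> R :=
  fun k => fine (esum (~` [set k]) (riesz_term alpha x k)^\+%E -
                 esum (~` [set k]) (riesz_term alpha x k)^\-%E)%E.

(* Main.v *)
(* Write W = omega^q, sigma = omega^{-p'}.  The A(p,q) condition and Hoelder's
   inequality make W doubling, hence also reverse doubling:
   W(S_{k,4^n}) <= theta W(S_{k,4^{n+1}}) with theta < 1.  Cutting the kernel
   into shells of radius 4^n gives |I_alpha x(k)| <= C sum_n b_n(k) with
     b_n(k) = 4^{n(alpha-1)} sum_{S_{k,4^n}} |x|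
           <= C (sum_{S_{k,4^n}} |x|^p omega^p)^{1/p} W(S_{k,4^n})^{-1/q}.
   Fix S = S_{m,N}, k in S and 4^M comparable to N.  For n >= M the Morrey norm
   bounds b_n(k) by ||x|| W(S_{k,4^n})^{alpha-1/q}; here alpha < 1/q because
   q < 2p, so the sum over n >= M is geometric.  For n < M, apply the Morrey
   bound only to the power q - p of b_n(k); summing the remaining power p
   against W over k in S costs a constant by doubling, and reverse doubling
   gives
     sum_{k in S} W(k) b_n(k)^q <= C (||x|| W(S)^alpha)^q theta^{(M-n) alpha (q-p)},
   so Minkowski's inequality closes the estimate.  Thus the gain q > p at each
   scale replaces the boundedness of maximal or Riesz operators on l^p. *)
Require Import Defs.
From HB Require Import structures.
From mathcomp Require Import all_boot all_order all_algebra finmap.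
From mathcomp Require Import all_classical all_reals all_analysis.
From mathcomp Require Import zify ring lra.

Set Implicit Arguments.
Unset Strict Implicit.
Unset Printing Implicit Defensive.

Import Order.TTheory GRing.Theory Num.Theory.
Import numFieldNormedType.Exports.

Local Open Scope classical_set_scope.
Local Open Scope ring_scope.

(** * Real powers and Hoelder's inequality for finite sums *)

Lemma sum_powR_ge0 (R : realType) (I : Type) (r : seq I) (f : I -> R) (p : R) :
  0 <= \sum_(i <- r) f i `^ p.
Proof. by apply: sumr_ge0 => i _; exact: powR_ge0. Qed.

Lemma powRVK (R : realType) (a p : R) :
  0 <= a -> p != 0 -> (a `^ p^-1) `^ p = a.
Proof. by move=> a0 p0; rewrite -powRrM mulVf// powRr1. Qed.

Lemma powRKV (R : realType) (a p : R) :
  0 <= a -> p != 0 -> (a `^ p) `^ p^-1 = a.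
Proof. by move=> a0 p0; rewrite -powRrM divff// powRr1. Qed.

(** Induction on the list: the norms of the two tails are the second coordinates in the two-term
    inequality [hoelder2]. *)
Lemma hoelder_sum (R : realType) (I : Type) (r : seq I) (f g : I -> R) (p q : R) :
  0 < p -> 0 < q -> p^-1 + q^-1 = 1 ->
  (forall i, 0 <= f i) -> (forall i, 0 <= g i) ->
  \sum_(i <- r) f i * g i <=
  (\sum_(i <- r) f i `^ p) `^ p^-1 * (\sum_(i <- r) g i `^ q) `^ q^-1.
Proof.
move=> p0 q0 pq f0 g0; elim: r => [|i r IH].
  by rewrite !big_nil !powR0 ?invr_eq0 ?gt_eqF// mulr0.
rewrite !big_cons.
have := sum_powR_ge0 r f p; have := sum_powR_ge0 r g q; move: IH.
move: (\sum_(j <- r) f j `^ p) (\sum_(j <- r) g j `^ q) => S T IH T0 S0.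
have := powRVK T0 (lt0r_neq0 q0); have := powRVK S0 (lt0r_neq0 p0).
move: IH (powR_ge0 S p^-1) (powR_ge0 T q^-1).
move: (S `^ p^-1) (T `^ q^-1) => A B IH A0 B0 <- <-.
apply: le_trans (hoelder2 (f0 _) A0 (g0 _) B0 p0 q0 pq).
by rewrite lerD2l.
Qed.

(** * Sums over balls *)

(** A duplicate-free list, so that sums over balls can be reindexed, exchanged and compared by
    inclusion. *)
Definition ball_seq (m : int) (N : nat) : seq int :=
  [seq m - N%:Z + j%:Z | j <- iota 0 N.*2.+1].

Lemma mem_ball_seq m N i : (i \in ball_seq m N) = (`|i - m| <= N%:Z).
Proof.
apply/mapP/idP => [[j]|h]; first by rewrite mem_iota => ? ->; lia.
exists (absz (i - m + N%:Z)); last by lia.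
by rewrite mem_iota; lia.
Qed.

Lemma ball_seq_uniq m N : uniq (ball_seq m N).
Proof. by rewrite map_inj_uniq ?iota_uniq// => i j; lia. Qed.

Lemma size_ball_seq m N : size (ball_seq m N) = N.*2.+1.
Proof. by rewrite size_map size_iota. Qed.

Lemma ball_int_seq m N : ball_int m N = [set` ball_seq m N]%classic.
Proof. by apply/seteqP; split => i /=; rewrite /ball_int /= mem_ball_seq. Qed.

Lemma sum_ball (R : realType) (f : int -> R) m N :
  \sum_(k \in ball_int m N) f k = \sum_(k <- ball_seq m N) f k.
Proof. by rewrite ball_int_seq -fsbig_seq// ball_seq_uniq. Qed.

Lemma card_ball_int m N : #|` fset_set (ball_int m N)|%fset = N.*2.+1.
Proof.
rewrite -(size_ball_seq m N); apply: perm_size; apply: uniq_perm.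
- exact: fset_uniq.
- exact: ball_seq_uniq.
- move=> i; rewrite ball_int_seq in_fset_set//; last exact: finite_seq.
  by apply/idP/idP; rewrite inE.
Qed.

Lemma int_interval_ball m N : int_interval (ball_int m N).
Proof.
exists (m - N%:Z), (m + N%:Z); split; first by lia.
by apply/seteqP; split => i /=; rewrite /ball_int /= in_itv /=; lia.
Qed.

Lemma ler_sum_subseq (R : realType) (I : eqType) (r s : seq I) (f : I -> R) :
  uniq r -> uniq s -> {subset r <= s} -> (forall i, 0 <= f i) ->
  \sum_(i <- r) f i <= \sum_(i <- s) f i.
Proof.
move=> ur us rs f0; rewrite [leRHS](bigID (mem r))/=.
rewrite -[X in _ <= X + _]big_filter [X in _ <= X + _](perm_big r); last first.
  apply: uniq_perm => // [|i]; first exact: filter_uniq.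
  rewrite mem_filter; apply/andP/idP => [[]//|ir]; split=> //; exact: rs.
by rewrite lerDl sumr_ge0.
Qed.

Definition vol (R : realType) (v : int -> R) (m : int) (N : nat) : R :=
  \sum_(k <- ball_seq m N) v k.

Lemma wsum_ball (R : realType) (v : int -> R) m N :
  wsum v (ball_int m N) = vol v m N.
Proof. exact: sum_ball. Qed.

Lemma vol_ge0 (R : realType) (v : int -> R) m N :
  (forall k, 0 <= v k) -> 0 <= vol v m N.
Proof. by move=> v0; apply: sumr_ge0 => i _. Qed.

Lemma vol_subset (R : realType) (v : int -> R) m N m' N' :
  (forall k, 0 <= v k) -> {subset ball_seq m' N' <= ball_seq m N} ->
  vol v m' N' <= vol v m N.
Proof. by move=> v0 sub; rewrite /vol ler_sum_subseq ?ball_seq_uniq. Qed.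

Lemma vol_ge_center (R : realType) (v : int -> R) m N :
  (forall k, 0 <= v k) -> v m <= vol v m N.
Proof.
move=> v0; have -> : v m = \sum_(k <- [:: m]) v k by rewrite big_seq1.
apply: ler_sum_subseq; rewrite ?ball_seq_uniq// => i.
by rewrite inE => /eqP ->; rewrite mem_ball_seq; lia.
Qed.

Lemma vol_gt0 (R : realType) (v : int -> R) m N :
  is_weight v -> 0 < vol v m N.
Proof.
by move=> v0; apply: lt_le_trans (v0 m) (vol_ge_center _ _ _) => k; exact: ltW.
Qed.

Lemma wpow_weight (R : realType) (w : int -> R) (r : R) :
  is_weight w -> is_weight (wpow w r).
Proof. by move=> w0 k; exact: powR_gt0. Qed.

(** * Consequences of the A(p,q) condition *)

Lemma powRD_gt0 (R : realType) (x a b : R) :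
  0 < x -> x `^ (a + b) = x `^ a * x `^ b.
Proof. by move=> x0; rewrite powRD// (gt_eqF x0) implybT. Qed.

Lemma powR_mono (R : realType) (r x y : R) :
  0 <= r -> 0 <= x -> x <= y -> x `^ r <= y `^ r.
Proof.
by move=> r0 x0 xy; rewrite ge0_ler_powR// nnegrE//; exact: le_trans xy.
Qed.

(** Isolates the second factor of the A(p,q) product on one interval: [n] is its cardinality, [x]
    and [y] are the two weight sums. *)
Lemma powR_scale_le (R : realType) (n x y a b A : R) :
  0 < n -> 0 < x -> 0 < y ->
  (n^-1 * x) `^ a * (n^-1 * y) `^ b <= A ->
  y `^ b <= A * n `^ (a + b) * x `^ (- a).
Proof.
move=> n0 x0 y0; have n0' := ltW n0; rewrite !(powRM, invr_ge0) ?(ltW x0, ltW y0)//.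
rewrite -[n^-1]powR_inv1// -!powRrM !mulN1r.
rewrite powRD_gt0// !powRN.
have := powR_gt0 a n0; have := powR_gt0 b n0; have := powR_gt0 a x0.
move: (x `^ a) (n `^ b) (n `^ a) (y `^ b) => c d e f c0 d0 e0 h.
rewrite ler_pdivlMr// -ler_pdivrMr ?mulr_gt0//.
apply: le_trans h; rewrite le_eqVlt; apply/orP; left; apply/eqP; field.
by rewrite !gt_eqF.
Qed.

Lemma A_pq_ball (R : realType) (p q : R) (w : int -> R) :
  is_weight w -> A_pq p q w ->
  exists A : R, 0 < A /\ forall m N,
    vol (wpow w (- conj_exp p)) m N `^ (conj_exp p)^-1 <=
    A * (N.*2.+1)%:R `^ (q^-1 + (conj_exp p)^-1) *
    vol (wpow w q) m N `^ (- q^-1).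
Proof.
move=> w0; rewrite /A_pq; set S := (X in ereal_sup X) => supS.
have Sub y : S y%:E -> y <= fine (ereal_sup S).
  move=> Sy; have ySup := ereal_sup_ubound Sy.
  have : ereal_sup S \is a fin_num.
    by rewrite fin_numE -ltey supS andbT gt_eqF//; exact: lt_le_trans (ltNyr _) ySup.
  by move/fineK => supE; rewrite -lee_fin supE.
(* Absolute value and [+ 1] give a positive constant without any lower bound on the supremum. *)
exists (`|fine (ereal_sup S)| + 1); split=> [|m N]; first exact: ltr_wpDl.
set A := `|_| + 1.
have /Sub : S (average (ball_int m N) (wpow w q) `^ q^-1 *
    average (ball_int m N) (wpow w (- conj_exp p)) `^ (conj_exp p)^-1)%:E.
  by exists (ball_int m N) => //; exact: int_interval_ball.
rewrite /average card_ball_int !sum_ball -!/(vol _ _ _).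
move=> h; apply: powR_scale_le; rewrite ?ltr0n//.
- exact: vol_gt0 (wpow_weight q w0).
- exact: vol_gt0 (wpow_weight _ w0).
- by apply: le_trans h _; rewrite /A (le_trans (ler_norm _))// lerDl.
Qed.

(* The ratio 8 covers every pair of balls that has to be compared. *)
Definition doubling (R : realType) (v : int -> R) (D : R) : Prop :=
  forall m N m' N', {subset ball_seq m' N' <= ball_seq m N} ->
    (N.*2.+1 <= 8 * N'.*2.+1)%N -> vol v m N <= D * vol v m' N'.

(** Hoelder on the small ball S' bounds |S'| through W(S') and sigma(S'). Enlarging sigma(S') to
    sigma(S) and using A(p,q) on S brings in a negative power of W(S); the comparable cardinalities
    cancel. *)
Lemma A_pq_doubling (R : realType) (p q : R) (w : int -> R) :
  1 < p -> 0 < q -> is_weight w -> A_pq p q w ->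
  exists D : R, 1 < D /\ doubling (wpow w q) D.
Proof.
move=> p1 q0 w0 /(A_pq_ball w0)[A [A0 hA]].
have r0 : 0 < conj_exp p by rewrite divr_gt0 ?subr_gt0// (lt_trans _ p1).
move: (conj_exp p) r0 hA => r r0 hA.
set t := q^-1 + r^-1 in hA.
have t0 : 0 < t by rewrite addr_gt0 ?invr_gt0.
(* The [+ 1] forces [1 < D], so that [1 - D^-1] lies strictly between 0 and 1. *)
exists ((A * 8 `^ t) `^ q + 1); split=> [|m N m' N' sub NN'].
  by rewrite ltrDr powR_gt0// mulr_gt0// powR_gt0.
have W0 := vol_gt0 m N (wpow_weight q w0).
have W0' := vol_gt0 m' N' (wpow_weight q w0).
have card : (N'.*2.+1)%:R `^ t <= vol (wpow w q) m' N' `^ q^-1 *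
   vol (wpow w (- r)) m N `^ r^-1.
  have tn := lt0r_neq0 t0.
  (* As t = 1/q + 1/r, the exponents q t and r t are conjugate; Hoelder is applied to 1 = w^(1/t)
     w^(-1/t). *)
  have conj : (q * t)^-1 + (r * t)^-1 = 1 by rewrite !invfM -mulrDl -/t divff.
  have := hoelder_sum (ball_seq m' N') (mulr_gt0 q0 t0) (mulr_gt0 r0 t0) conj
    (fun i => powR_ge0 (w i) t^-1) (fun i => powR_ge0 (w i) (- t^-1)).
  under eq_bigr => i _ do rewrite -powRD_gt0// subrr powRr0.
  rewrite big_const_seq count_predT size_ball_seq iter_addr addr0.
  under [X in _ <= X `^ _ * _ -> _]eq_bigr => i _ do
    rewrite -powRrM mulrCA mulVf// mulr1.
  under [X in _ <= _ * X `^ _ -> _]eq_bigr => i _ do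
    rewrite -powRrM mulNr mulrCA mulVf// mulr1.
  move=> /(powR_mono (ltW t0) (ler0n _ _)) /le_trans; apply.
  rewrite powRM ?powR_ge0// -!(powRrM _ _ t) !invfM -!mulrA !mulVf// !mulr1.
  apply: ler_wpM2l; first exact: powR_ge0.
  apply: powR_mono.
  - by rewrite invr_ge0 ltW.
  - exact/ltW/vol_gt0/wpow_weight.
  - by apply: vol_subset => // k; rewrite ltW// wpow_weight.
have {card} : (N'.*2.+1)%:R `^ t <= vol (wpow w q) m' N' `^ q^-1 *
    (A * (8 `^ t * (N'.*2.+1)%:R `^ t) * vol (wpow w q) m N `^ (- q^-1)).
  apply: (le_trans card); apply: ler_wpM2l; first exact: powR_ge0.
  apply: (le_trans (hA _ _)); apply: ler_wpM2r; first exact: powR_ge0.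
  apply: ler_wpM2l; first exact: ltW.
  rewrite -powRM ?ler0n//; apply: (powR_mono (ltW t0) (ler0n _ _)).
  by rewrite -natrM ler_nat.
have n0 : 0 < (N'.*2.+1)%:R `^ t :> R by rewrite powR_gt0 ?ltr0n.
move: (_%:R `^ t) n0 => n n0.
have e0 : 0 < (8 : R) `^ t by rewrite powR_gt0.
move: (8 `^ t) e0 => e e0.
move: (vol _ m N) (vol _ m' N') W0 W0' => V V' V0 V0'.
rewrite powRN => h.
have {}h : V `^ q^-1 <= A * e * V' `^ q^-1.
  have c0 := powR_gt0 q^-1 V0.
  rewrite -(ler_pM2l n0) -ler_pdivlMr//.
  apply: (le_trans h); rewrite le_eqVlt; apply/orP; left; apply/eqP; ring.
have := powR_mono (ltW q0) (powR_ge0 _ _) h.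
rewrite powRM ?powR_ge0//; last exact/ltW/mulr_gt0.
rewrite (powRVK (ltW V0) (lt0r_neq0 q0)) (powRVK (ltW V0') (lt0r_neq0 q0)).
by move=> /le_trans; apply; rewrite ler_wpM2r ?lerDl// ltW.
Qed.

(** * Reverse doubling along the radii 4^n *)

Lemma ball_seq_subset m N m' N' :
  `|m' - m| + N'%:Z <= N%:Z -> {subset ball_seq m' N' <= ball_seq m N}.
Proof. by move=> h i; rewrite !mem_ball_seq; lia. Qed.

(* The larger ball contains a disjoint translate of the smaller one. *)
Lemma doubling_reverse (R : realType) (v : int -> R) (D : R) k N N' :
  is_weight v -> 1 < D -> doubling v D -> (3 * N < N')%N ->
  (N'.*2.+1 <= 8 * N.*2.+1)%N ->
  vol v k N <= (1 - D^-1) * vol v k N'.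
Proof.
(* A shift by 2N+1 makes the balls disjoint; the translate reaches k+3N+1, hence [3 * N < N']. *)
move=> v0 D1 dv NN' N'N; pose c := k + (N.*2.+1)%:Z.
have sub1 : {subset ball_seq k N <= ball_seq k N'}.
  by apply: ball_seq_subset; lia.
have sub2 : {subset ball_seq c N <= ball_seq k N'}.
  by apply: ball_seq_subset; rewrite /c; lia.
have le2 : vol v k N + vol v c N <= vol v k N'.
  rewrite /vol -big_cat; apply: ler_sum_subseq; rewrite ?ball_seq_uniq//.
  - rewrite cat_uniq !ball_seq_uniq andbT andTb; apply/hasPn => i.
    by rewrite /= !mem_ball_seq /c; lia.
  - by move=> i; rewrite mem_cat => /orP[/sub1|/sub2].
  - by move=> i; exact/ltW/v0.
have leD : D^-1 * vol v k N' <= vol v c N.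
  by rewrite ler_pdivrMl ?(lt_trans _ D1)//; exact: dv.
by rewrite mulrBl mul1r; lra.
Qed.

Lemma doubling_reverse_iter (R : realType) (v : int -> R) (D : R) k n l :
  is_weight v -> 1 < D -> doubling v D ->
  vol v k (4 ^ n) <= (1 - D^-1) ^+ l * vol v k (4 ^ (n + l)).
Proof.
move=> v0 D1 dv; elim: l => [|l IH]; first by rewrite addn0 expr0 mul1r.
have th0 : 0 <= 1 - D^-1 by rewrite subr_ge0 invf_le1 ?ltW// (lt_trans _ D1).
apply: (le_trans IH); rewrite exprSr -mulrA; apply: ler_wpM2l.
  exact: exprn_ge0.
have : (0 < 4 ^ (n + l))%N by rewrite expn_gt0.
by move=> ?; apply: doubling_reverse => //; rewrite addnS expnS; lia.
Qed.

(** * Tools for summing over scales *)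

Lemma expn4_scale N : exists M, (N <= 4 ^ M <= N.*2.*2.+1)%N.
Proof.
(* The [+ 1] in the upper bound 4N+1 admits N = 0 with M = 0. *)
elim: N => [|N [M /andP[h1 h2]]]; first by exists 0%N.
have [h|h] := leqP N.+1 (4 ^ M)%N; first by exists M; lia.
by exists M.+1; rewrite expnS; have : (0 < 4 ^ M)%N by [rewrite expn_gt0]; lia.
Qed.

(** After exchanging the sums, [y j] is multiplied by the sum of v(k)/v(S_{k,r}) over k in S_{j,r}.
    This is at most D, because S_{j,r} lies in S_{k,2r}, whose volume is at most D v(S_{k,r}). *)
Lemma sum_vol_ratio (R : realType) (v y : int -> R) (D : R) m N r :
  is_weight v -> doubling v D -> 0 <= D -> (forall k, 0 <= y k) ->
  \sum_(k <- ball_seq m N) v k * (vol y k r / vol v k r) <=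
  D * vol y m (N + r).
Proof.
move=> v0 dv D0 y0.
have V0 k : 0 < vol v k r by exact: vol_gt0.
(* A membership test over the common index set S_{m,N+r} allows the exchange. *)
have -> : \sum_(k <- ball_seq m N) v k * (vol y k r / vol v k r) =
    \sum_(k <- ball_seq m N) \sum_(j <- ball_seq m (N + r))
      (if j \in ball_seq k r then v k / vol v k r * y j else 0).
  rewrite big_seq [RHS]big_seq; apply: eq_bigr => k kN.
  rewrite mulrCA mulrA mulrC mulrC -mulrA mulrC {1}/vol.
  rewrite -big_mkcond -mulr_sumr; congr (_ * _).
  rewrite -[RHS]big_filter; apply: perm_big; apply: uniq_perm.
  - exact: ball_seq_uniq.
  - exact/filter_uniq/ball_seq_uniq.
  - move=> j; rewrite mem_filter !mem_ball_seq.
    by move: kN; rewrite mem_ball_seq; lia.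
rewrite exchange_big /= {2}/vol mulr_sumr; apply: ler_sum => j _.
rewrite -big_mkcond -mulr_suml; apply: ler_wpM2r => //.
have -> : D = D / vol v j r * vol v j r by rewrite mulfVK// gt_eqF.
rewrite {3}/vol mulr_sumr.
apply: (@le_trans _ _ (\sum_(k <- ball_seq m N | j \in ball_seq k r)
  D / vol v j r * v k)).
  apply: ler_sum => k; rewrite mem_ball_seq => jk.
  rewrite mulrC; apply: ler_wpM2r; first exact/ltW/v0.
  rewrite ler_pdivlMr// mulrC ler_pdivrMr//.
  apply: (@le_trans _ _ (vol v k (r + r))).
    apply: vol_subset => [i|]; first exact/ltW/v0.
    by apply: ball_seq_subset; lia.
  by apply: dv; [apply: ball_seq_subset|]; lia.
rewrite -big_filter; apply: ler_sum_subseq.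
- exact/filter_uniq/ball_seq_uniq.
- exact: ball_seq_uniq.
- by move=> k; rewrite mem_filter !mem_ball_seq; lia.
- by move=> k; rewrite mulr_ge0 ?divr_ge0// ltW.
Qed.

Lemma geometric_sum_le (R : realType) (z : R) n : 0 <= z < 1 ->
  \sum_(i < n) z ^+ i <= (1 - z)^-1.
Proof.
move=> /andP[z0 z1]; have z1' : 0 < 1 - z by rewrite subr_gt0.
rewrite -div1r ler_pdivlMr// -lerN2 -mulrN opprB mulrC -subrX1.
by rewrite lerBrDr addNr exprn_ge0.
Qed.

Lemma powR_exprn (R : realType) (x r : R) n :
  0 <= x -> (x `^ r) ^+ n = (x ^+ n) `^ r.
Proof.
move=> x0; elim: n => [|n IH]; first by rewrite !expr0 powR1.
by rewrite !exprS IH powRM// exprn_ge0.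
Qed.

(* Minkowski's inequality, from Hoelder's inequality with weights rho ^ l. *)
Lemma geometric_minkowski (R : realType) (I : Type) (s : seq I) (v : I -> R)
    (c : nat -> I -> R) (q rho G : R) n :
  1 < q -> 0 < rho -> rho < 1 -> 0 <= G -> (forall k, 0 <= v k) ->
  (forall l k, 0 <= c l k) ->
  (forall l, (l < n)%N ->
     \sum_(k <- s) v k * c l k `^ q <= G * (rho ^+ l) `^ q) ->
  \sum_(k <- s) v k * (\sum_(l < n) c l k) `^ q <= G * (1 - rho)^-1 `^ q.
Proof.
move=> q1 rho0 rho1 G0 v0 c0 hG.
have q0 : 0 < q by lra.
have qN0 := lt0r_neq0 q0.
have r0 : 0 < q / (q - 1) by rewrite divr_gt0// subr_gt0.
have qr : (q / (q - 1))^-1 + q^-1 = 1 by field; rewrite qN0 subr_eq0 gt_eqF.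
set E := \sum_(l < n) rho ^+ l.
have E0 : 0 <= E by apply: sumr_ge0 => l _; rewrite exprn_ge0// ltW.
have rl l : 0 < rho ^+ l by rewrite exprn_gt0.
(* Hoelder on c_l = rho^(l(1-1/q)) rho^(l(1/q-1)) c_l: the first factors sum to [E], the others
   carry the weights rho^(l(1-q)). *)
have pt k : (\sum_(l < n) c l k) `^ q <=
    E `^ (q - 1) * \sum_(l < n) (rho ^+ l) `^ (1 - q) * c l k `^ q.
  have := hoelder_sum (index_enum 'I_n) r0 q0 qr
    (fun l : 'I_n => powR_ge0 (rho ^+ l) (1 - q^-1))
    (fun l : 'I_n => mulr_ge0 (powR_ge0 (rho ^+ l) (q^-1 - 1)) (c0 l k)).
  under eq_bigr => l _ do
    rewrite mulrA -powRD_gt0// addrA subrK subrr powRr0 mul1r.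
  under [X in _ <= X `^ _ * _ -> _]eq_bigr => l _.
    rewrite -powRrM; have -> : (1 - q^-1) * (q / (q - 1)) = 1.
      by field; rewrite qN0 subr_eq0 gt_eqF.
    rewrite powRr1 ?(ltW (rl l))//; over.
  under [X in _ <= _ * X `^ _ -> _]eq_bigr => l _ do
    rewrite powRM ?powR_ge0// -powRrM mulrBl mulVf// mul1r.
  have s0 : 0 <= \sum_(l < n) c l k by apply: sumr_ge0.
  move=> /(powR_mono (ltW q0) s0) h; apply: (le_trans h).
  rewrite powRM ?powR_ge0//.
  rewrite powRVK//; last first.
    by apply: sumr_ge0 => l _; rewrite mulr_ge0 ?powR_ge0.
  by rewrite -powRrM invf_div mulfVK.
apply: (@le_trans _ _ (\sum_(l < n) E `^ (q - 1) * (rho ^+ l) `^ (1 - q) *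
    \sum_(k <- s) v k * c l k `^ q)).
  under [leRHS]eq_bigr => l _ do rewrite mulr_sumr.
  rewrite exchange_big /=; apply: ler_sum => k _.
  apply: (le_trans (ler_wpM2l (v0 k) (pt k))); rewrite !mulr_sumr.
  by apply: ler_sum => l _; rewrite le_eqVlt; apply/orP; left; apply/eqP; ring.
(* The hypothesis supplies rho^(lq), which against the weight rho^(l(1-q)) leaves rho^l. *)
apply: (@le_trans _ _ (\sum_(l < n) E `^ (q - 1) * G * rho ^+ l)).
  apply: ler_sum => l _; apply: (@le_trans _ _ (E `^ (q - 1) *
      (rho ^+ l) `^ (1 - q) * (G * (rho ^+ l) `^ q))).
    by apply: ler_wpM2l; [rewrite mulr_ge0 ?powR_ge0|exact: hG].
  rewrite -mulrA [_ * (G * _)]mulrCA -powRD_gt0// subrK powRr1 ?(ltW (rl l))//.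
  by rewrite mulrA.
rewrite -mulr_sumr -/E mulrAC [E `^ _ * E]mulrC mulr_powRB1// mulrC.
apply: ler_wpM2l => //; apply: (powR_mono (ltW q0) E0).
by apply: geometric_sum_le; rewrite rho1 ltW.
Qed.

(** * Estimates at a single scale *)

Lemma vol_enlarge (R : realType) (v : int -> R) (D : R) m N r :
  doubling v D -> (r <= N.*2.*2.+1)%N -> vol v m (N + r) <= D * vol v m N.
Proof. by move=> dv rN; apply: dv; [apply: ball_seq_subset|]; lia. Qed.

Lemma vol_recenter (R : realType) (v : int -> R) m N k r :
  is_weight v -> k \in ball_seq m N -> vol v k r <= vol v m (N + r).
Proof.
rewrite mem_ball_seq => v0 kN; apply: vol_subset => [i|]; first exact/ltW/v0.
by apply: ball_seq_subset; lia.
Qed.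

Lemma vol_le_recenter (R : realType) (v : int -> R) (D : R) m N k r :
  is_weight v -> doubling v D -> (N <= r)%N -> k \in ball_seq m N ->
  vol v m N <= D * vol v k r.
Proof.
rewrite mem_ball_seq => v0 dv Nr kN; apply: (@le_trans _ _ (vol v m (N + r))).
  apply: vol_subset => [i|]; first exact/ltW/v0.
  by apply: ball_seq_subset; lia.
by apply: dv; [apply: ball_seq_subset|]; lia.
Qed.

(** Small radii, with [v] = W and [y] = |x|^p omega^p: the power q - p of [b] is bounded by the
    Morrey hypothesis and reverse doubling, which yields the decay in [l]; the remaining power p
    becomes the ratio treated by [sum_vol_ratio]. *)
Lemma level_small (R : realType) (v y b : int -> R) (p q alpha D A K : R)
    (m : int) (N n l : nat) :
  is_weight v -> 1 < D -> doubling v D -> (forall k, 0 <= y k) ->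
  0 <= A -> 0 <= K -> 0 < p -> p < q -> 0 < alpha ->
  (forall m N, vol y m N <= (K * vol v m N `^ alpha) `^ p) ->
  (forall k, 0 <= b k <=
     A * vol y k (4 ^ n) `^ p^-1 * vol v k (4 ^ n) `^ (- q^-1)) ->
  (N <= 4 ^ (n + l) <= N.*2.*2.+1)%N ->
  \sum_(k <- ball_seq m N) v k * b k `^ q <=
  A `^ q * D `^ (alpha * q + 1) * K `^ q * vol v m N `^ (alpha * q) *
  ((1 - D^-1) ^+ l) `^ (alpha * (q - p)).
Proof.
move=> v0 D1 dv y0 A0 K0 p0 pq al0 morrey hb /andP[NM MN].
have q0 : 0 < q by exact: lt_trans pq.
have D0 : 0 < D by exact: lt_trans D1.
have qp0 : 0 <= q - p by rewrite subr_ge0 ltW.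
have th0 : 0 <= 1 - D^-1 by rewrite subr_ge0 invf_le1// ltW.
have V0 := vol_gt0 m N v0.
set V := vol v m N in V0 *; set t := (1 - D^-1) ^+ l.
have t0 : 0 <= t by exact: exprn_ge0.
have tDV0 : 0 <= t * (D * V) by rewrite mulr_ge0// mulr_ge0// ltW.
have volQ r : (r <= 4 ^ (n + l))%N -> vol v m (N + r) <= D * V.
  by move=> hr; apply: vol_enlarge => //; exact: leq_trans MN.
have Vn k : k \in ball_seq m N -> vol v k (4 ^ n) <= t * (D * V).
  move=> kN; apply: (le_trans (doubling_reverse_iter k n l v0 D1 dv)).
  apply: ler_wpM2l; first exact: t0.
  apply: le_trans (volQ (4 ^ (n + l))%N (leqnn _)).
  exact: vol_recenter.
have bq k : k \in ball_seq m N -> b k `^ q <=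
    A `^ q * (K * (t * (D * V)) `^ alpha) `^ (q - p) *
    (vol y k (4 ^ n) / vol v k (4 ^ n)).
  move=> kN; have Vk0 := vol_gt0 k (4 ^ n)%N v0.
  have /andP[b0 {}hb] := hb k.
  apply: (le_trans (powR_mono (ltW q0) b0 hb)).
  have X0 := vol_ge0 k (4 ^ n)%N y0.
  have X1 : vol y k (4 ^ n) `^ p^-1 <= K * (t * (D * V)) `^ alpha.
    have p0' : 0 <= p^-1 by rewrite invr_ge0 ltW.
    apply: (le_trans (powR_mono p0' X0 (morrey k (4 ^ n)%N))).
    rewrite powRKV ?gt_eqF//; last by rewrite mulr_ge0 ?powR_ge0.
    apply: ler_wpM2l; first exact: K0.
    by apply: powR_mono (Vn k kN); exact: ltW.
  rewrite powRM ?mulr_ge0 ?powR_ge0// powRM ?powR_ge0//.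
  have -> : vol v k (4 ^ n) `^ (- q^-1) `^ q = (vol v k (4 ^ n))^-1.
    by rewrite -powRrM mulNr mulVf ?gt_eqF// powR_inv1// ltW.
  (* Splitting q = (q - p) + p frees one full factor y(S_{k,4^n}). *)
  have -> : vol y k (4 ^ n) `^ p^-1 `^ q =
      vol y k (4 ^ n) `^ p^-1 `^ (q - p) * vol y k (4 ^ n).
    rewrite -{3}(@powRVK _ (vol y k (4 ^ n)) p) ?gt_eqF// -powRD ?subrK//.
    by rewrite gt_eqF.
  rewrite -!mulrA; apply: ler_wpM2l; first exact: powR_ge0.
  apply: ler_wpM2r; first by rewrite divr_ge0// ltW.
  by apply: powR_mono => //; exact: powR_ge0.
set C := A `^ q * (K * (t * (D * V)) `^ alpha) `^ (q - p) in bq.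
have C0 : 0 <= C by rewrite mulr_ge0 ?powR_ge0.
apply: (@le_trans _ _ (\sum_(k <- ball_seq m N)
   C * (v k * (vol y k (4 ^ n) / vol v k (4 ^ n))))).
  rewrite big_seq [leRHS]big_seq; apply: ler_sum => k kN.
  rewrite mulrCA; apply: ler_wpM2l; first exact/ltW/v0.
  exact: bq.
rewrite -mulr_sumr.
have r4 : (4 ^ n <= 4 ^ (n + l))%N by rewrite leq_exp2l// leq_addr.
(* The exchanged sum lives on S_{m,N+4^n}, whose volume is still at most D V. *)
have Q : vol y m (N + 4 ^ n) <= (K * (D * V) `^ alpha) `^ p.
  apply: (le_trans (morrey _ _)); apply: powR_mono; first exact: ltW.
    by rewrite mulr_ge0 ?powR_ge0.
  apply: ler_wpM2l; first exact: K0.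
  apply: powR_mono (volQ _ r4); first exact: ltW.
  by apply/ltW/vol_gt0.
apply: (@le_trans _ _ (C * (D * (K * (D * V) `^ alpha) `^ p))).
  apply: ler_wpM2l; first exact: C0.
  apply: (le_trans (sum_vol_ratio _ _ _ v0 dv (ltW D0) y0)).
  by apply: ler_wpM2l; [exact: ltW|exact: Q].
rewrite /C; move: t t0 {tDV0 Vn bq C C0} => t t0.
have DV0 : 0 <= D * V by rewrite mulr_ge0// ltW.
have -> : K * (t * (D * V)) `^ alpha = t `^ alpha * (K * (D * V) `^ alpha).
  by rewrite (powRM _ t0 DV0) mulrCA.
have [Z hZ] : exists Z, Z = K * (D * V) `^ alpha by eexists.
rewrite -hZ.
have Z0 : 0 <= Z by rewrite hZ mulr_ge0 ?powR_ge0.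
(* The two powers recombine to Z^q; its D^(alpha q) and the D of [sum_vol_ratio] explain the
   exponent alpha q + 1. *)
have ZZ : Z `^ (q - p) * Z `^ p = K `^ q * D `^ (alpha * q) * V `^ (alpha * q).
  rewrite -powRD; last by rewrite subrK gt_eqF.
  rewrite subrK hZ powRM ?powR_ge0// (powRM _ (ltW D0) (ltW V0)).
  by rewrite powRM ?powR_ge0// -!powRrM mulrA.
rewrite powRM ?powR_ge0// -powRrM (powRD_gt0 _ _ D0) (powRr1 (ltW D0)).
rewrite le_eqVlt; apply/orP; left; apply/eqP.
rewrite (_ : A `^ q * _ * _ =
    A `^ q * t `^ (alpha * (q - p)) * D * (Z `^ (q - p) * Z `^ p)); last by ring.
by rewrite ZZ; ring.
Qed.

(** For large radii the Morrey hypothesis leaves v(S_{k,4^n})^(alpha-1/q), a negative power, which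
    reverse doubling turns into geometric decay. *)
Lemma level_large (R : realType) (v y : int -> R) (b : nat -> int -> R)
    (p q alpha D A K : R) (m : int) (N M L : nat) k :
  is_weight v -> 1 < D -> doubling v D -> (forall k, 0 <= y k) ->
  0 <= A -> 0 <= K -> 0 < p -> 0 < alpha -> alpha < q^-1 ->
  (forall m N, vol y m N <= (K * vol v m N `^ alpha) `^ p) ->
  (forall n k, b n k <=
     A * vol y k (4 ^ n) `^ p^-1 * vol v k (4 ^ n) `^ (- q^-1)) ->
  (N <= 4 ^ M)%N -> k \in ball_seq m N ->
  \sum_(n < L) b (M + n)%N k <=
  A * K * D `^ (q^-1 - alpha) * (1 - (1 - D^-1) `^ (q^-1 - alpha))^-1 *
  vol v m N `^ (alpha - q^-1).
Proof.
move=> v0 D1 dv y0 A0 K0 p0 al0 alq morrey hb NM kN.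
set e := q^-1 - alpha.
have e0 : 0 < e by rewrite subr_gt0.
have D0 : 0 < D by exact: lt_trans D1.
have th0 : 0 < 1 - D^-1 by rewrite subr_gt0 invf_lt1.
have th1 : 1 - D^-1 < 1 by rewrite ltrBlDr ltrDl invr_gt0.
have V0 := vol_gt0 m N v0.
set V := vol v m N in V0 *; set z := (1 - D^-1) `^ e.
have z1 : 0 <= z < 1.
  rewrite powR_ge0/=; have := gt0_ltr_powR e0 (_ : 1 - D^-1 \in Num.nneg) (_ : 1 \in Num.nneg) th1.
  by rewrite powR1 !nnegrE ler01 ltW//; apply.
have term n : b (M + n)%N k <= A * K * D `^ e * V `^ (- e) * z ^+ n.
  apply: (le_trans (hb _ _)).
  have W0 := vol_gt0 k (4 ^ (M + n))%N v0.
  have X1 : vol y k (4 ^ (M + n)) `^ p^-1 <= K * vol v k (4 ^ (M + n)) `^ alpha.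
    have p0' : 0 <= p^-1 by rewrite invr_ge0 ltW.
    apply: (le_trans (powR_mono p0' (vol_ge0 _ _ y0) (morrey _ _))).
    by rewrite powRKV ?gt_eqF// mulr_ge0 ?powR_ge0.
  (* Doubling compares S_{m,N} with S_{k,4^M}; [n] steps of reverse doubling lead on to
     S_{k,4^(M+n)}. *)
  have VW : V <= D * (1 - D^-1) ^+ n * vol v k (4 ^ (M + n)).
    rewrite -mulrA; apply: (@le_trans _ _ (D * vol v k (4 ^ M))); last first.
      apply: ler_wpM2l; first exact: ltW.
      exact: doubling_reverse_iter.
    exact: vol_le_recenter.
  move: (vol v k _) (vol y k _ `^ _) W0 X1 VW => W X W0 XK VW.
  have {VW} := powR_mono (ltW e0) (ltW V0) VW.
  have tn0 : 0 <= (1 - D^-1) ^+ n by rewrite exprn_ge0// ltW.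
  have DN := ltW D0; have WN := ltW W0.
  rewrite !powRM ?mulr_ge0// -powR_exprn ?(ltW th0)// -/z => VW.
  apply: (@le_trans _ _ (A * K * W `^ (- e))).
    rewrite /e opprB powRD_gt0// -!mulrA; apply: ler_wpM2l; first exact: A0.
    by rewrite mulrA; apply: ler_wpM2r; [exact: powR_ge0|exact: XK].
  rewrite -!mulrA; apply: ler_wpM2l; first exact: A0.
  apply: ler_wpM2l; first exact: K0.
  rewrite !powRN mulrCA mulrC ler_pdivlMr ?powR_gt0// mulrC.
  by rewrite ler_pdivrMr ?powR_gt0.
apply: (le_trans (ler_sum _ (fun (n : 'I_L) _ => term n))).
rewrite -mulr_sumr (_ : alpha - q^-1 = - e); last by rewrite opprB.
rewrite [leRHS]mulrAC; apply: ler_wpM2l; first by rewrite !mulr_ge0 ?powR_ge0.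
exact: geometric_sum_le.
Qed.

(** [U] majorizes all partial sums at once, so no infinite series enters: it adds one tail bound for
    radii from 4^M on to the finitely many levels below M. *)
Lemma level_sum (R : realType) (v : int -> R) (p q alpha D A : R) :
  is_weight v -> 1 < D -> doubling v D ->
  0 <= A -> 0 < p -> p < q -> 1 < q -> 0 < alpha -> alpha < q^-1 ->
  exists C : R, 0 < C /\
  forall (y : int -> R) (b : nat -> int -> R) (K : R), 0 <= K ->
  (forall k, 0 <= y k) ->
  (forall m N, vol y m N <= (K * vol v m N `^ alpha) `^ p) ->
  (forall n k, 0 <= b n k <=
     A * vol y k (4 ^ n) `^ p^-1 * vol v k (4 ^ n) `^ (- q^-1)) ->
  forall m N, exists U : int -> R,
  [/\ forall k, 0 <= U k,
      forall k L, k \in ball_seq m N -> \sum_(n < L) b n k <= U k &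
      \sum_(k <- ball_seq m N) v k * U k `^ q <=
      C * (K * vol v m N `^ alpha) `^ q].
Proof.
move=> v0 D1 dv A0 p0 pq q1 al0 alq.
have q0 : 0 < q by lra.
have D0 : 0 < D by exact: lt_trans D1.
set e := q^-1 - alpha.
have e0 : 0 < e by rewrite subr_gt0.
set th := 1 - D^-1.
have th0 : 0 < th by rewrite subr_gt0 invf_lt1.
have th1 : th < 1 by rewrite ltrBlDr ltrDl invr_gt0.
have powth r : 0 < r -> th `^ r < 1.
  move=> r0; have := gt0_ltr_powR r0 (_ : th \in Num.nneg) (_ : 1 \in Num.nneg) th1.
  by rewrite powR1 !nnegrE ler01 (ltW th0); apply.
set bt := alpha * (q - p).
have bt0 : 0 < bt by rewrite mulr_gt0// subr_gt0.
(* Chosen so that rho^q = th^bt, the decay per scale in [level_small]. *)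
set rho := th `^ (bt / q).
have rho0 : 0 < rho by exact: powR_gt0.
have rho1 : rho < 1 by apply: powth; exact: divr_gt0.
(* [T0] and [C1] are the constants of [level_large] and [level_small]. *)
set T0 := A * D `^ e * (1 - th `^ e)^-1.
have T00 : 0 <= T0.
  by rewrite !mulr_ge0 ?powR_ge0// invr_ge0 subr_ge0 ltW// powth.
set C1 := A `^ q * D `^ (alpha * q + 1).
have C10 : 0 <= C1 by rewrite mulr_ge0 ?powR_ge0.
exists ((C1 + T0 `^ q) * (1 - rho)^-1 `^ q + 1); split.
  by rewrite ltr_wpDl// mulr_ge0 ?powR_ge0// addr_ge0 ?powR_ge0.
move=> y b K K0 y0 morrey hb m N.
have [M /andP[NM MN]] := expn4_scale N.
have V0 := vol_gt0 m N v0.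
set V := vol v m N in V0 *.
pose T := T0 * K * V `^ (alpha - q^-1).
have T_ge0 : 0 <= T by rewrite mulr_ge0 ?powR_ge0// mulr_ge0.
(* Entry 0 is the whole tail, entry l > 0 the level M - l: the weighted q-sums decay geometrically
   in l. *)
pose c l k := if l is l'.+1 then b (M - l'.+1)%N k else T.
have b0 n k : 0 <= b n k by case/andP: (hb n k).
have bA n k : b n k <=
   A * vol y k (4 ^ n) `^ p^-1 * vol v k (4 ^ n) `^ (- q^-1).
  by case/andP: (hb n k).
have c0 l k : 0 <= c l k by case: l => [|l]; [exact: T_ge0|exact: b0].
exists (fun k => \sum_(l < M.+1) c l k); split.
- by move=> k; apply: sumr_ge0.
(* Padding to M + L nonnegative levels separates those below M from the tail. *)
- move=> k L kN; apply: (@le_trans _ _ (\sum_(n < M + L) b n k)).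
    rewrite addnC big_split_ord /=; rewrite lerDl.
    by apply: sumr_ge0.
  rewrite big_split_ord big_ord_recl /= addrC.
  apply: lerD.
    apply: (le_trans (level_large L v0 D1 dv y0 A0 K0 p0 al0 alq morrey bA NM kN)).
    by rewrite le_eqVlt; apply/orP; left; apply/eqP; rewrite /T /T0 /th /e; ring.
  rewrite (reindex_inj rev_ord_inj) le_eqVlt; apply/orP; left; apply/eqP.
  exact: eq_bigr.
set G := (C1 + T0 `^ q) * (K * V `^ alpha) `^ q.
have G0 : 0 <= G by rewrite mulr_ge0 ?powR_ge0// addr_ge0 ?powR_ge0.
have KV : (K * V `^ alpha) `^ q = K `^ q * V `^ (alpha * q).
  by rewrite powRM ?powR_ge0// -powRrM.
apply: (@le_trans _ _ (G * (1 - rho)^-1 `^ q)); last first.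
  rewrite /G mulrAC; apply: ler_wpM2r; first exact: powR_ge0.
  by rewrite lerDl.
apply: geometric_minkowski => //; first by move=> k; exact/ltW/v0.
case=> [_|l lM].
  (* [T] is constant on the ball, so V T^q carries the power 1 + q(alpha - 1/q) = alpha q of V. *)
  have -> : \sum_(k <- ball_seq m N) v k * c 0%N k `^ q = V * T `^ q.
    by rewrite /V /vol mulr_suml.
  rewrite expr0 powR1 mulr1 /T.
  rewrite (powRM _ (mulr_ge0 T00 K0) (powR_ge0 _ _)) (powRM _ T00 K0).
  rewrite -powRrM mulrBl mulVf ?gt_eqF//.
  rewrite mulrCA -{1}(powRr1 (ltW V0)) -powRD_gt0// [1 + _]addrC subrK.
  rewrite /G KV -mulrA; apply: ler_wpM2r; first by rewrite mulr_ge0 ?powR_ge0.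
  by rewrite lerDr.
have -> : (rho ^+ l.+1) `^ q = (th ^+ l.+1) `^ bt.
  by rewrite /rho powR_exprn ?(ltW th0)// -powRrM divfK ?gt_eqF.
have nl : (M - l.+1 + l.+1 = M)%N by exact: subnK.
have NMl : (N <= 4 ^ (M - l.+1 + l.+1) <= N.*2.*2.+1)%N by rewrite nl NM MN.
have hbl := hb (M - l.+1)%N.
apply: (le_trans (level_small m v0 D1 dv y0 A0 K0 p0 pq al0 morrey hbl NMl)).
rewrite -/V -/bt -/C1 -/th; apply: ler_wpM2r; first exact: powR_ge0.
rewrite /G KV -mulrA; apply: ler_wpM2r; first by rewrite mulr_ge0 ?powR_ge0.
by rewrite lerDl powR_ge0.
Qed.

(** * Riesz potentials *)

(** This is b_n(k); the full ball replaces the shell, which only enlarges the sum. *)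
Definition level (R : realType) (alpha : R) (x : int -> R) (n : nat) (k : int)
    : R :=
  (4 ^ n)%:R `^ (alpha - 1) * \sum_(i <- ball_seq k (4 ^ n)) `|x i|.

Lemma level_ge0 (R : realType) (alpha : R) (x : int -> R) n k :
  0 <= level alpha x n k.
Proof. by rewrite mulr_ge0 ?powR_ge0// sumr_ge0. Qed.

(** Induction on L: where 4^L < |k-i| <= 4^(L+1), the kernel is at most 4^(L(alpha-1)), that is
    4^(1-alpha) times the factor in level L+1. *)
Lemma kernel_le_level (R : realType) (alpha : R) (x : int -> R) k (s : seq int) L :
  alpha <= 1 -> uniq s -> k \notin s -> {subset s <= ball_seq k (4 ^ L)} ->
  \sum_(i <- s) `|x i| / (`|k - i|%:~R `^ (1 - alpha)) <=
  4 `^ (1 - alpha) * \sum_(n < L.+1) level alpha x n k.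
Proof.
move=> al1 + + +; have al1' : 0 <= 1 - alpha by rewrite subr_ge0.
elim: L s => [|L IH] s us ks sL.
  rewrite big_ord1 /level /= expn0 powR1 mul1r.
  apply: (@le_trans _ _ (\sum_(i <- s) `|x i|)).
    rewrite big_seq [leRHS]big_seq; apply: ler_sum => i si.
    (* With [k] excluded, the ball of radius 1 has only points at distance 1. *)
    have -> : `|k - i| = 1.
      have ik : i != k by apply: contraNneq ks => <-.
      by move: (sL i si); rewrite mem_ball_seq expn0; lia.
    by rewrite powR1 divr1.
  apply: (@le_trans _ _ (\sum_(i <- ball_seq k 1) `|x i|)).
    by apply: ler_sum_subseq; rewrite ?ball_seq_uniq.
  rewrite ler_peMl ?sumr_ge0//.
  by rewrite -[leLHS](powRr0 4) ler_powR// ler1n.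
rewrite (bigID (mem (ball_seq k (4 ^ L)))) /= big_ord_recr /= mulrDr.
apply: lerD.
  rewrite -big_filter; apply: IH.
  - exact: filter_uniq.
  - by rewrite mem_filter negb_and ks orbT.
  - by move=> i; rewrite mem_filter => /andP[].
have -> : 4 `^ (1 - alpha) * level alpha x L.+1 k =
    ((4 ^ L)%:R `^ (1 - alpha))^-1 * \sum_(i <- ball_seq k (4 ^ L.+1)) `|x i|.
  rewrite /level mulrA; congr (_ * _).
  rewrite -(opprB 1 alpha) powRN expnS natrM powRM ?ler0n// invfM mulrA.
  by rewrite divff ?mul1r// gt_eqF// powR_gt0// ltr0n.
apply: (@le_trans _ _ (\sum_(i <- s | i \notin ball_seq k (4 ^ L))
    ((4 ^ L)%:R `^ (1 - alpha))^-1 * `|x i|)).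
  apply: ler_sum => i; rewrite mem_ball_seq -ltNge => ik.
  rewrite mulrC; apply: ler_wpM2r => //.
  have L0 : 0 < (4 ^ L)%:R `^ (1 - alpha) :> R.
    by rewrite powR_gt0// ltr0n expn_gt0.
  have Lk : (4 ^ L)%:R <= `|k - i|%:~R :> R.
    by rewrite -[(4 ^ L)%:R]/((4 ^ L)%N%:Z%:~R) ler_int; lia.
  have Lk' := powR_mono al1' (ler0n _ _) Lk.
  by rewrite lef_pV2// posrE//; exact: lt_le_trans Lk'.
rewrite -mulr_sumr; apply: ler_wpM2l; first by rewrite invr_ge0 powR_ge0.
rewrite -big_filter; apply: ler_sum_subseq => //.
- exact: filter_uniq.
- exact: ball_seq_uniq.
- by move=> i; rewrite mem_filter => /andP[_ /sL].
Qed.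

Lemma ball_seq_exhaust k (s : seq int) :
  exists L, {subset s <= ball_seq k (4 ^ L)}.
Proof.
elim: s => [|i s [L IH]]; first by exists 0%N.
exists (maxn L (absz (i - k))) => j; rewrite inE => /predU1P[->|/IH].
  have lt_exp : (absz (i - k) < 4 ^ absz (i - k))%N by exact: ltn_expl.
  have : (4 ^ absz (i - k) <= 4 ^ maxn L (absz (i - k)))%N.
    by rewrite leq_exp2l// leq_maxr.
  by move=> /(leq_trans lt_exp); rewrite mem_ball_seq; lia.
have : (4 ^ L <= 4 ^ maxn L (absz (i - k)))%N by rewrite leq_exp2l// leq_maxl.
by rewrite !mem_ball_seq; lia.
Qed.

(** Hoelder on |x| = (|x| omega) omega^(-1), then the A(p,q) bound; the cardinality appears to the
    power 1 - alpha and cancels the factor in [level]. *)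
Lemma level_le (R : realType) (alpha p q A : R) (w x : int -> R) n k :
  is_weight w -> 0 <= A -> 1 < p -> q^-1 + (conj_exp p)^-1 = 1 - alpha ->
  0 <= 1 - alpha ->
  (forall m N,
    vol (wpow w (- conj_exp p)) m N `^ (conj_exp p)^-1 <=
    A * (N.*2.+1)%:R `^ (q^-1 + (conj_exp p)^-1) *
    vol (wpow w q) m N `^ (- q^-1)) ->
  level alpha x n k <= A * 3 `^ (1 - alpha) *
    vol (fun i => `|x i| `^ p * wpow w p i) k (4 ^ n) `^ p^-1 *
    vol (wpow w q) k (4 ^ n) `^ (- q^-1).
Proof.
move=> w0 A0 p1 qp al1 hA.
have p0 : 0 < p by exact: lt_trans p1.
have r0 : 0 < conj_exp p by rewrite divr_gt0 ?subr_gt0.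
have pr : p^-1 + (conj_exp p)^-1 = 1.
  by rewrite /conj_exp; field; rewrite subr_eq0 !gt_eqF.
have w0' i : 0 <= w i by exact/ltW/w0.
have {}hA := hA k (4 ^ n)%N.
rewrite qp in hA; move: (conj_exp p) r0 pr hA {qp} => r r0 pr hA.
have sumx : \sum_(i <- ball_seq k (4 ^ n)) `|x i| <=
    vol (fun i => `|x i| `^ p * wpow w p i) k (4 ^ n) `^ p^-1 *
    vol (wpow w (- r)) k (4 ^ n) `^ r^-1.
  have := hoelder_sum (ball_seq k (4 ^ n)) p0 r0 pr
    (fun i => mulr_ge0 (normr_ge0 (x i)) (w0' i)) (fun i => powR_ge0 (w i) (-1)).
  under eq_bigr => i _ do
    rewrite (powR_inv1 (w0' i)) mulfK ?(lt0r_neq0 (w0 i))//.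
  under [X in _ <= X `^ _ * _ -> _]eq_bigr => i _ do
    rewrite (powRM _ (normr_ge0 _) (w0' i)).
  under [X in _ <= _ * X `^ _ -> _]eq_bigr => i _ do
    rewrite -powRrM mulN1r.
  exact.
(* The factor 3 comes from 2*4^n + 1 <= 3*4^n. *)
have card : ((4 ^ n).*2.+1)%:R `^ (1 - alpha) <=
    3 `^ (1 - alpha) * (4 ^ n)%:R `^ (1 - alpha) :> R.
  rewrite -powRM ?ler0n//; apply: (powR_mono al1 (ler0n _ _)).
  rewrite -natrM ler_nat; have : (0 < 4 ^ n)%N by rewrite expn_gt0.
  by move: (4 ^ n)%N => M; lia.
have F0 : 0 < (4 ^ n)%:R `^ (1 - alpha) :> R.
  by rewrite powR_gt0// ltr0n expn_gt0.
rewrite /level -(opprB 1 alpha) powRN mulrC ler_pdivrMr//.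
apply: (le_trans sumx).
set X := vol _ _ _ `^ p^-1; have X0 : 0 <= X by exact: powR_ge0.
move: X X0 => X X0.
apply: (@le_trans _ _ (X * (A * (3 `^ (1 - alpha) * (4 ^ n)%:R `^ (1 - alpha)) *
    vol (wpow w q) k (4 ^ n) `^ (- q^-1)))).
  apply: ler_wpM2l; first exact: X0.
  apply: (le_trans hA); apply: ler_wpM2r; first exact: powR_ge0.
  by apply: ler_wpM2l; [exact: A0|exact: card].
by rewrite le_eqVlt; apply/orP; left; apply/eqP; ring.
Qed.

(** * Absolute convergence and size of the potential *)

Lemma esum_riesz_le (R : realType) (alpha U : R) (x : int -> R) k :
  (forall s : seq int, uniq s -> k \notin s ->
    \sum_(i <- s) `|x i| / (`|k - i|%:~R `^ (1 - alpha)) <= U) ->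
  (esum (~` [set k]) (fun i => `|riesz_term alpha x k i|) <= U%:E)%E.
Proof.
(* [esum] is a supremum of finite sums, so a bound uniform over finite lists suffices. *)
move=> hU; apply: ge_ereal_sup => _ [X [finX Xk] <-].
rewrite fsbig_finite//=; under eq_bigr => i _ do
  rewrite /riesz_term /= normrM normfV (ger0_norm (powR_ge0 _ _)).
rewrite sumEFin lee_fin; apply: hU; first exact: fset_uniq.
by rewrite in_fset_set//; apply/negP; rewrite inE => /Xk /=; exact.
Qed.

(** The sums of positive and negative parts both lie in [0,U], so they are finite and their
    difference lies in [-U,U]. *)
Lemma riesz_norm_le (R : realType) (alpha U : R) (x : int -> R) k :
  (esum (~` [set k]) (fun i => `|riesz_term alpha x k i|) <= U%:E)%E ->
  `|riesz alpha x k| <= U.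
Proof.
move=> hU; rewrite /riesz.
have pos : (0 <= esum (~` [set k]) (riesz_term alpha x k)^\+ <= U%:E)%E.
  apply/andP; split; first by apply: esum_ge0 => i _; exact: funepos_ge0.
  apply: le_trans hU; apply: le_esum => i _.
  by rewrite funeposE ge_max lee_abs abse_ge0.
have neg : (0 <= esum (~` [set k]) (riesz_term alpha x k)^\- <= U%:E)%E.
  apply/andP; split; first by apply: esum_ge0 => i _; exact: funeneg_ge0.
  apply: le_trans hU; apply: le_esum => i _.
  by rewrite funenegE ge_max -abseN lee_abs abse_ge0.
move: (esum _ _) (esum _ _) pos neg => [a| |] [b| |] //=;
  rewrite ?leye_eq ?andbF// !lee_fin => /andP[a0 aU] /andP[b0 bU].
by rewrite ler_norml; lra.
Qed.

Theorem theorem4p8 (R : realType) (alpha p q s : R) (w : int -> R)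
  (alpha_gt0 : 0 < alpha) (alpha_lt1 : alpha < 1)
  (p_gt1 : 1 < p) (p_lt : p < alpha^-1)
  (q_def : q^-1 = p^-1 - alpha) (q_lt : q < 2 * p)
  (s_def : s = q * p / (2 * p - q))
  (w_weight : is_weight w) (w_Apq : A_pq p q w) :
  (forall x : int -> R, in_morrey p q (wpow w p) (wpow w q) x ->
     riesz_defined alpha x /\
     in_morrey q s (wpow w q) (wpow w q) (riesz alpha x)) /\
  (exists C : R, 0 < C /\
     forall x : int -> R, in_morrey p q (wpow w p) (wpow w q) x ->
       (morrey_norm q s (wpow w q) (wpow w q) (riesz alpha x) <=
        C%:E * morrey_norm p q (wpow w p) (wpow w q) x)%E).
Proof.
have p0 : 0 < p by exact: lt_trans p_gt1.
(* The condition [p < alpha^-1] makes 1/q positive. *)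
have q0 : 0 < q.
  by rewrite -invr_gt0 q_def subr_gt0 -[p^-1]invrK -ltf_pV2// ?posrE ?invr_gt0// !invrK.
have pq : p < q by rewrite -ltf_pV2 ?posrE// q_def gtrBl.
have q1 : 1 < q by exact: lt_trans pq.
(* Here q < 2p enters: alpha = 1/p - 1/q < 1/q. *)
have alq : alpha < q^-1.
  have -> : alpha = p^-1 - q^-1 by rewrite q_def; ring.
  have : (2 * p)^-1 < q^-1 by rewrite ltf_pV2// posrE// mulr_gt0.
  by rewrite invfM; lra.
(* Since 1/s = 2/q - 1/p, source and target norms carry the same volume exponent -alpha. *)
have qs : s^-1 - q^-1 = - alpha.
  have -> : alpha = p^-1 - q^-1 by rewrite q_def; ring.
  by rewrite s_def; field; rewrite !gt_eqF ?subr_gt0.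
have qp : q^-1 - p^-1 = - alpha by rewrite q_def; ring.
have al1 : 0 <= 1 - alpha by rewrite subr_ge0 ltW.
have qr : q^-1 + (conj_exp p)^-1 = 1 - alpha.
  by rewrite q_def /conj_exp; field; rewrite subr_eq0 !gt_eqF.
have v_weight := wpow_weight q w_weight.
have [A [A0 hA]] := A_pq_ball w_weight w_Apq.
have [D [D1 dv]] := A_pq_doubling p_gt1 q0 w_weight w_Apq.
set A' := A * 3 `^ (1 - alpha).
have A'0 : 0 <= A' by rewrite mulr_ge0 ?powR_ge0// ltW.
have [C [C0 hC]] := level_sum v_weight D1 dv A'0 p0 pq q1 alpha_gt0 alq.
set c := 4 `^ (1 - alpha) : R.
have c0 : 0 < c by rewrite powR_gt0.
have main x : in_morrey p q (wpow w p) (wpow w q) x ->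
    riesz_defined alpha x /\
    (morrey_norm q s (wpow w q) (wpow w q) (riesz alpha x) <=
     (c * C `^ q^-1)%:E * morrey_norm p q (wpow w p) (wpow w q) x)%E.
  rewrite /in_morrey; set norm := morrey_norm p q _ _ x => norm_fin.
  pose y i := `|x i| `^ p * wpow w p i.
  have y0 i : 0 <= y i by rewrite mulr_ge0 ?powR_ge0.
  have le_norm m N :
      ((vol (wpow w q) m N `^ (- alpha) * vol y m N `^ p^-1)%:E <= norm)%E.
    apply: ereal_sup_ubound; exists m => //; exists N => //.
    by rewrite qp wsum_ball sum_ball.
  have norm_ge0 : (0 <= norm)%E.
    by apply: le_trans (le_norm 0 0%N); rewrite lee_fin mulr_ge0 ?powR_ge0.
  have : norm \is a fin_num by rewrite ge0_fin_numE.
  move=> /fineK; move: (fine norm) => K normE.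
  move: le_norm norm_ge0; rewrite -normE lee_fin {norm_fin normE norm} => leK K0.
  (* The Morrey bound solved for the local sum, as the scale estimates require. *)
  have morrey m N : vol y m N <= (K * vol (wpow w q) m N `^ alpha) `^ p.
    have V0 := vol_gt0 m N v_weight.
    rewrite -(powRVK (vol_ge0 m N y0) (lt0r_neq0 p0)).
    apply: (powR_mono (ltW p0) (powR_ge0 _ _)).
    by rewrite -ler_pdivrMr ?powR_gt0// mulrC -powRN -lee_fin.
  have hb n k := conj (level_ge0 alpha x n k)
    (level_le x n k w_weight (ltW A0) p_gt1 qr al1 hA).
  have {}hC := hC y (level alpha x) K K0 y0 morrey (fun n k => introT andP (hb n k)).
  have bound m N : exists U : int -> R, [/\ forall k, 0 <= U k,
      forall k, k \in ball_seq m N ->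
        (esum (~` [set k])%classic (fun i => `|riesz_term alpha x k i|) <=
         (c * U k)%:E)%E &
      \sum_(k <- ball_seq m N) wpow w q k * U k `^ q <=
      C * (K * vol (wpow w q) m N `^ alpha) `^ q].
    have [U [U0 bU sU]] := hC m N; exists U; split=> // k kN.
    apply: esum_riesz_le => r ur kr; have [L rL] := ball_seq_exhaust k r.
    apply: (le_trans (kernel_le_level x (ltW alpha_lt1) ur kr rL)).
    by apply: ler_wpM2l; [exact: ltW|exact: bU].
  split.
    (* The ball of radius 0 centred at [k] already gives summability at [k]. *)
    move=> k; have [U [_ + _]] := bound k 0%N.
    move=> /(_ k); rewrite mem_ball_seq subrr normr0 => /(_ isT) hU.
    by rewrite /summable; apply: le_lt_trans hU _; rewrite ltry.
  apply: ge_ereal_sup => _ [m _ [N _ <-]].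
  rewrite qs wsum_ball sum_ball -EFinM lee_fin.
  have [U [U0 bU sU]] := bound m N.
  have V0 := vol_gt0 m N v_weight.
  move: (vol _ m N) V0 sU => V V0 sU.
  have sI : \sum_(k <- ball_seq m N) `|riesz alpha x k| `^ q * wpow w q k <=
      (c * (C `^ q^-1 * (K * V `^ alpha))) `^ q.
    rewrite !powRM ?mulr_ge0 ?powR_ge0// ?(ltW c0)//.
    rewrite (powRVK (ltW C0) (lt0r_neq0 q0)) -powRM ?powR_ge0//.
    apply: (@le_trans _ _ (\sum_(k <- ball_seq m N) c `^ q * (wpow w q k * U k `^ q))).
      rewrite big_seq [leRHS]big_seq; apply: ler_sum => k kN.
      rewrite mulrCA mulrC; apply: ler_wpM2l; first exact/ltW/v_weight.
      rewrite -(powRM _ (ltW c0) (U0 k)).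
      apply: (powR_mono (ltW q0) (normr_ge0 _)).
      exact/riesz_norm_le/bU.
    by rewrite -mulr_sumr; apply: ler_wpM2l; [exact: powR_ge0|exact: sU].
  have q0' : 0 <= q^-1 by rewrite invr_ge0 ltW.
  have I0 : 0 <= \sum_(k <- ball_seq m N) `|riesz alpha x k| `^ q * wpow w q k.
    by apply: sumr_ge0 => k _; rewrite mulr_ge0 ?powR_ge0.
  have := powR_mono q0' I0 sI.
  rewrite powRKV ?gt_eqF//; last by rewrite !mulr_ge0 ?powR_ge0// ltW.
  (* The factor V^(-alpha) cancels V^alpha, leaving c C^(1/q) K for every ball. *)
  move=> sI'; rewrite powRN mulrC ler_pdivrMr ?powR_gt0//.
  apply: (le_trans sI').
  by rewrite le_eqVlt; apply/orP; left; apply/eqP; ring.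
split; last first.
  exists (c * C `^ q^-1); split; first by rewrite mulr_gt0// powR_gt0.
  by move=> x /main[].
move=> x xM; have [xR xle] := main x xM; split; first exact: xR.
apply: (le_lt_trans xle); apply: lte_mul_pinfty; last exact: xM.
  by rewrite lee_fin mulr_ge0 ?powR_ge0// ltW.
by [].
Qed.
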